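(* Let $f_1,f_2,f_3,f_4\in\mathbb{C}[x,y]$ be binary quadratic forms which are pairwise distinct (no two are proportional) and satisfy $f_1^3+f_2^3=f_3^3+f_4^3$. Then there exist $\lambda\in\mathbb{C}$ with $\lambda(\lambda^6-1)\neq 0$ and an invertible linear change $M$ such that the family $\{\{f_1\circ M,f_2\circ M\},\{f_3\circ M,f_4\circ M\}\}$, or one of its flips, is identified with the family $\{\{F_{3,\lambda},F_{4,\lambda}\},\{F_{5,\lambda},F_{6,\lambda}\}\}$.
   Context: Let $\omega=e^{2\pi i/3}$. A linear change is $M(x,y)=(\alpha x+\beta y,\gamma x+\delta y)$ with $\alpha\delta-\beta\gamma\neq0$, and $(f\circ M)(x,y)=f(\alpha x+\beta y,\gamma x+\delta y)$. For $\lambda\in\mathbb{C}$ define $F_{3,\lambda}=\lambda^3\omega^2x^2-xy+\lambda^3\omega y^2$, $F_{4,\lambda}=-\lambda\omega^2x^2+\lambda^4xy-\lambda\omega y^2$, $F_{5,\lambda}=\lambda^3\omega x^2-xy+\lambda^3\omega^2y^2$, $F_{6,\lambda}=-\lambda\omega x^2+\lambda^4xy-\lambda\omega^2y^2$; these satisfy $F_{3,\lambda}^3+F_{4,\lambda}^3=F_{5,\lambda}^3+F_{6,\lambda}^3$. A family $\{\{g_1,g_2\},\{g_3,g_4\}\}$ encodes the identity $g_1^3+g_2^3=g_3^3+g_4^3$; two families $\{\{g_1,g_2\},\{g_3,g_4\}\}$ and $\{\{h_1,h_2\},\{h_3,h_4\}\}$ are identified if $\{\{g_1^3,g_2^3\},\{g_3^3,g_4^3\}\}=\{\{h_1^3,h_2^3\},\{h_3^3,h_4^3\}\}$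 as sets of sets. The flips of the family $\{\{g_1,g_2\},\{g_3,g_4\}\}$ are the families $\{\{g_1,-g_3\},\{-g_2,g_4\}\}$ and $\{\{g_1,-g_4\},\{-g_2,g_3\}\}$ (encoding $g_1^3-g_3^3=-g_2^3+g_4^3$ and $g_1^3-g_4^3=-g_2^3+g_3^3$). *)

(* Defs.v *)
From mathcomp Require Import all_boot all_order all_algebra.
From mathcomp Require Import finmap.
From mathcomp Require Import complex.
From mathcomp Require Import reals trigo.
From mathcomp Require Import mpoly.

Set Implicit Arguments.
Unset Strict Implicit.
Unset Printing Implicit Defensive.

Import GRing.Theory Num.Theory.
Local Open Scope ring_scope.
Local Open Scope complex_scope.

(* e^(2 pi i / 3) *)
Definition omega (R : realType) : R[i] :=
  cos (2 * pi / 3) +i* sin (2 * pi / 3).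

Section Forms.
Variable C : fieldType.

Definition X : {mpoly C[2]} := 'X_(0 : 'I_2).
Definition Y : {mpoly C[2]} := 'X_(1 : 'I_2).

(* The zero form, which \is 2.-homog, is proportional to every form. *)
Definition proportional (f g : {mpoly C[2]}) : Prop :=
  exists a b : C, (a, b) != (0, 0) /\ a *: f = b *: g.

(* f o M, where M(x, y) = (M 0 0 x + M 0 1 y, M 1 0 x + M 1 1 y). *)
Definition linear_change (M : 'M[C]_2) (f : {mpoly C[2]}) : {mpoly C[2]} :=
  f \mPo [tuple M i 0 *: X + M i 1 *: Y | i < 2].

(* ((g1, g2), (g3, g4)) represents the family {{g1, g2}, {g3, g4}}. *)
Definition family : Type :=
  ({mpoly C[2]} * {mpoly C[2]}) * ({mpoly C[2]} * {mpoly C[2]}).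

Definition cubes (G : family) : {fset {fset {mpoly C[2]}}} :=
  let: ((g1, g2), (g3, g4)) := G in
  [fset [fset g1 ^+ 3; g2 ^+ 3]; [fset g3 ^+ 3; g4 ^+ 3]]%fset.

Definition identified (G H : family) : Prop := cubes G = cubes H.

Definition flip1 (G : family) : family :=
  let: ((g1, g2), (g3, g4)) := G in ((g1, - g3), (- g2, g4)).

Definition flip2 (G : family) : family :=
  let: ((g1, g2), (g3, g4)) := G in ((g1, - g4), (- g2, g3)).

End Forms.

Section Families.
Variables (R : realType) (l : R[i]).
Local Notation w := (omega R).
Local Notation x := (X R[i]).
Local Notation y := (Y R[i]).

Definition F3 : {mpoly R[i][2]} :=
  (l ^+ 3 * w ^+ 2) *: x ^+ 2 - x * y + (l ^+ 3 * w) *: y ^+ 2.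
Definition F4 : {mpoly R[i][2]} :=
  - (l * w ^+ 2) *: x ^+ 2 + l ^+ 4 *: (x * y) - (l * w) *: y ^+ 2.
Definition F5 : {mpoly R[i][2]} :=
  (l ^+ 3 * w) *: x ^+ 2 - x * y + (l ^+ 3 * w ^+ 2) *: y ^+ 2.
Definition F6 : {mpoly R[i][2]} :=
  - (l * w) *: x ^+ 2 + l ^+ 4 *: (x * y) - (l * w ^+ 2) *: y ^+ 2.

Definition Ffamily : family R[i] := ((F3, F4), (F5, F6)).

End Families.

(* Main.v *)
(* The four forms lie in a three-dimensional space, so they satisfy a linear
   relation, i.e. the curve (f1 : f2 : f3 : f4) is contained in a plane section
   of the Fermat cubic surface u1^3 + u2^3 = u3^3 + u4^3.  This section contains
   a conic, hence also a residual line, and every line of the surface has the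
   form u_i^3 = +-u_j^3, u_k^3 = +-u_m^3.  Up to flips and cube roots of unity
   the linear relation is therefore f1 - f3 = t (f4 - f2).  Putting l^2 = t,
   s = f4 - f2, u = f4 + f2 - l (f1 + f3), v = f4 + f2 + l (f1 + f3), the
   equation becomes 3 u v = (l^6 - 1) s^2, which forces u and v to be squares of
   independent linear forms and s a multiple of their product; choosing these
   linear forms as coordinates x + y, x - y up to scaling yields the family. *)

Require Import Defs.
From mathcomp Require Import finmap.
From mathcomp Require Import all_boot all_order all_algebra.
From mathcomp Require Import complex.
From mathcomp Require Import reals trigo.
From mathcomp Require Import mpoly.
From mathcomp Require Import ring.

Set Implicit Arguments.
Unset Strict Implicit.
Unset Printing Implicit Defensive.

Import GRing.Theory Num.Theory.
Local Open Scope ring_scope.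
Local Open Scope complex_scope.

(** * Relations between four cubes of linear forms in two variables *)

Section LinearCubes.
Variable C : numClosedFieldType.
Implicit Types x y : C.

(** Four points suffice: (1, 0) and (0, 1) give the outer coefficients, while the difference and the
    sum of the values at (1, 1) and (1, -1) are twice the inner ones. *)
Lemma cubic_monomial_coefs_eq0 (e0 e1 e2 e3 : C) :
  (forall s t : C, e0 * s ^+ 3 + e1 * s ^+ 2 * t + e2 * s * t ^+ 2
                   + e3 * t ^+ 3 = 0) ->
  [/\ e0 = 0, e1 = 0, e2 = 0 & e3 = 0].
Proof.
move=> H.
have h0 : e0 = 0 by have := H 1 0; rewrite !expr0n !mulr0 !addr0 expr1n mulr1.
have h3 : e3 = 0.
  by have := H 0 1; rewrite !expr0n !mulr0 !mul0r !add0r expr1n mulr1.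
have h1 := H 1 1; have h2 := H 1 (-1); rewrite h0 h3 in h1 h2.
have two : (2 : C) != 0 by rewrite pnatr_eq0.
split=> //; apply: (mulfI two); rewrite mulr0.
  by transitivity ((0 * 1 ^+ 3 + e1 * 1 ^+ 2 * 1 + e2 * 1 * 1 ^+ 2 + 0 * 1 ^+ 3)
     - (0 * 1 ^+ 3 + e1 * 1 ^+ 2 * (-1) + e2 * 1 * (-1) ^+ 2 + 0 * (-1) ^+ 3));
    [ring | rewrite h1 h2 subr0].
by transitivity ((0 * 1 ^+ 3 + e1 * 1 ^+ 2 * 1 + e2 * 1 * 1 ^+ 2 + 0 * 1 ^+ 3)
     + (0 * 1 ^+ 3 + e1 * 1 ^+ 2 * (-1) + e2 * 1 * (-1) ^+ 2 + 0 * (-1) ^+ 3));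
    [ring | rewrite h1 h2 addr0].
Qed.

Lemma cube_root1_inv (r : C) : r ^+ 3 = 1 -> r^-1 ^+ 3 = 1 /\ r != 0.
Proof.
move=> hr; rewrite exprVn hr invr1; split=> //.
apply/eqP=> r0; move: hr; rewrite r0 expr0n => /esym/eqP.
by rewrite oner_eq0.
Qed.

(** The equations say that s -> a s + b t, t -> c s + d t preserves s^3 + t^3. If no entry vanishes,
    the two mixed equations force a d = b c, and a singular substitution cannot preserve this form;
    so the matrix is monomial. *)
Lemma sum_two_cubes_matrix (a b c d : C) :
  a ^+ 3 + c ^+ 3 = 1 -> a ^+ 2 * b + c ^+ 2 * d = 0 ->
  a * b ^+ 2 + c * d ^+ 2 = 0 -> b ^+ 3 + d ^+ 3 = 1 ->
  [/\ a = 0, d = 0, c ^+ 3 = 1 & b ^+ 3 = 1] \/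
  [/\ b = 0, c = 0, a ^+ 3 = 1 & d ^+ 3 = 1].
Proof.
move=> h1 h2 h3 h4.
have nz1 (x : C) : x ^+ 3 = 1 -> x != 0 by case/cube_root1_inv.
have [a0|a0] := eqVneq a 0.
  left; rewrite a0 !expr0n !mul0r !add0r in h1 h2.
  have d0 : d = 0.
    by move/eqP: h2; rewrite mulf_eq0 expf_eq0 /= (negbTE (nz1 _ h1)) => /eqP.
  by rewrite d0 expr0n addr0 in h4.
have [b0|b0] := eqVneq b 0.
  right; rewrite b0 !expr0n !mulr0 !add0r in h3 h4.
  have c0 : c = 0.
    by move/eqP: h3; rewrite mulf_eq0 expf_eq0 /= (negbTE (nz1 _ h4)) orbF
      => /eqP.
  by rewrite c0 expr0n addr0 in h1.
have c0 : c != 0.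
  apply/eqP=> c0; move/eqP: h2; rewrite c0 expr0n mul0r addr0 mulf_eq0 expf_eq0.
  by rewrite (negbTE a0) (negbTE b0).
have d0 : d != 0.
  apply/eqP=> d0; move/eqP: h2; rewrite d0 mulr0 addr0 mulf_eq0 expf_eq0.
  by rewrite (negbTE a0) (negbTE b0).
have e : a * d = b * c.
  have : (a * b) * (c * d) * (a * d - b * c) = 0.
    transitivity (c * d * d * (a ^+ 2 * b + c ^+ 2 * d)
                  - c * c * d * (a * b ^+ 2 + c * d ^+ 2)); first by ring.
    by rewrite h2 h3 !mulr0 subr0.
  move/eqP; rewrite !mulf_eq0 (negbTE a0) (negbTE b0) (negbTE c0) (negbTE d0) /=.
  by rewrite subr_eq0 => /eqP.
(* With [a * d = b * c] the first column equation turns into [b = 0]. *)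
have : b * (a ^+ 3 + c ^+ 3) = a * (a ^+ 2 * b + c ^+ 2 * d).
  transitivity (a ^+ 3 * b + c ^+ 2 * (b * c)); first by ring.
  by rewrite -e; ring.
by rewrite h1 h2 mulr1 mulr0 => b0'; rewrite b0' eqxx in b0.
Qed.

(** Two linear forms with these coefficient vectors have the same cube. Vectors are used because
    they will be coordinates of quadratic forms modulo a third form. *)
Definition cube_assoc (x y x' y' : C) :=
  exists2 r : C, r ^+ 3 = 1 & x = r * x' /\ y = r * y'.

Lemma cube_assoc_sym x y x' y' : cube_assoc x y x' y' -> cube_assoc x' y' x y.
Proof.
case=> r hr [-> ->]; have [hi r0] := cube_root1_inv hr.
by exists r^-1 => //; rewrite !mulKf.
Qed.

Lemma cube_assocN x y x' y' :
  cube_assoc x y (- x') (- y') -> cube_assoc (- x) (- y) x' y'.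
Proof. by case=> r hr [-> ->]; exists r => //; rewrite !mulrN !opprK. Qed.

Lemma cube_assocNN x y x' y' :
  cube_assoc (- x) (- y) (- x') (- y') -> cube_assoc x y x' y'.
Proof. by move/cube_assocN; rewrite !opprK. Qed.

(** Two independent linear forms can serve as coordinates, in which the other two are given by a
    matrix preserving the sum of two cubes. *)
Lemma sum_two_cubes_indep (x1 y1 x2 y2 x3 y3 x4 y4 : C) :
  x1 * y2 != x2 * y1 ->
  (forall s t : C, (x1 * s + y1 * t) ^+ 3 + (x2 * s + y2 * t) ^+ 3
               = (x3 * s + y3 * t) ^+ 3 + (x4 * s + y4 * t) ^+ 3) ->
  (cube_assoc x1 y1 x3 y3 /\ cube_assoc x4 y4 x2 y2) \/
  (cube_assoc x1 y1 x4 y4 /\ cube_assoc x3 y3 x2 y2).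
Proof.
rewrite -subr_eq0 => D0 H.
(* Cramer's rule: the third and fourth forms expressed in the first two. *)
pose a := (x3 * y2 - x2 * y3) / (x1 * y2 - x2 * y1).
pose b := (x1 * y3 - x3 * y1) / (x1 * y2 - x2 * y1).
pose c := (x4 * y2 - x2 * y4) / (x1 * y2 - x2 * y1).
pose d := (x1 * y4 - x4 * y1) / (x1 * y2 - x2 * y1).
have ex3 : x3 = a * x1 + b * x2 by rewrite /a /b; field.
have ey3 : y3 = a * y1 + b * y2 by rewrite /a /b; field.
have ex4 : x4 = c * x1 + d * x2 by rewrite /c /d; field.
have ey4 : y4 = c * y1 + d * y2 by rewrite /c /d; field.
have {H} : forall s t : C, (a ^+ 3 + c ^+ 3 - 1) * s ^+ 3
   + (3 * (a ^+ 2 * b + c ^+ 2 * d)) * s ^+ 2 * t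
   + (3 * (a * b ^+ 2 + c * d ^+ 2)) * s * t ^+ 2
   + (b ^+ 3 + d ^+ 3 - 1) * t ^+ 3 = 0.
  move=> s t.
  (* The point ([S], [T]) is where the first form takes the value [s] and the second the value
     [t]. *)
  pose S := (s * y2 - t * y1) / (x1 * y2 - x2 * y1).
  pose T := (x1 * t - x2 * s) / (x1 * y2 - x2 * y1).
  have e1 : x1 * S + y1 * T = s by rewrite /S /T; field.
  have e2 : x2 * S + y2 * T = t by rewrite /S /T; field.
  have e3 : x3 * S + y3 * T = a * s + b * t by rewrite -e1 -e2 ex3 ey3; ring.
  have e4 : x4 * S + y4 * T = c * s + d * t by rewrite -e1 -e2 ex4 ey4; ring.
  have := H S T; rewrite e1 e2 e3 e4 => h.
  transitivity (((a * s + b * t) ^+ 3 + (c * s + d * t) ^+ 3)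
     - (s ^+ 3 + t ^+ 3)); first by ring.
  by rewrite h subrr.
have three : (3 : C) != 0 by rewrite pnatr_eq0.
case/cubic_monomial_coefs_eq0 => /eqP; rewrite subr_eq0 => /eqP h1.
move=> /eqP; rewrite mulf_eq0 (negbTE three) => /eqP h2.
move=> /eqP; rewrite mulf_eq0 (negbTE three) => /eqP h3.
move=> /eqP; rewrite subr_eq0 => /eqP h4.
case: (sum_two_cubes_matrix h1 h2 h3 h4) => [] [z1 z2 z3 z4].
  right; split; last by exists b => //; rewrite ex3 ey3 z1 !mul0r !add0r.
  by apply: cube_assoc_sym; exists c => //; rewrite ex4 ey4 z2 !mul0r !addr0.
left; split; last by exists d => //; rewrite ex4 ey4 z2 !mul0r !add0r.
by apply: cube_assoc_sym; exists a => //; rewrite ex3 ey3 z1 !mul0r !addr0.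
Qed.

(** Vanishing minors mean rank at most one. A vector with nonzero first coordinate generates all the
    others; if there is none, (0, 1) does. *)
Lemma collinear_vectors (I : finType) (x y : I -> C) :
  (forall i j, x i * y j = x j * y i) ->
  exists x0 y0 (c : I -> C), forall i, x i = c i * x0 /\ y i = c i * y0.
Proof.
move=> H; case: (pickP (fun i => x i != 0)) => [i xi0 | hx].
  exists (x i), (y i), (fun j => x j / x i) => j; split; first by rewrite divfK.
  by apply: (mulfI xi0); rewrite H; field.
exists 0, 1, y => i; split; last by rewrite mulr1.
by move/eqP: (hx i); rewrite mulr0.
Qed.

(** The first three cases are the three ways of pairing four cubes into two cancelling pairs, that
    is, the three types of lines on the Fermat cubic surface; in the last case all four forms are
    multiples of one. *)
Lemma four_linear_cubes (x1 y1 x2 y2 x3 y3 x4 y4 : C) :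
  (forall s t : C, (x1 * s + y1 * t) ^+ 3 + (x2 * s + y2 * t) ^+ 3
               = (x3 * s + y3 * t) ^+ 3 + (x4 * s + y4 * t) ^+ 3) ->
  [\/ cube_assoc x1 y1 x3 y3 /\ cube_assoc x4 y4 x2 y2,
      cube_assoc x1 y1 x4 y4 /\ cube_assoc x3 y3 x2 y2,
      cube_assoc x1 y1 (- x2) (- y2) /\ cube_assoc x4 y4 (- x3) (- y3) |
      exists x0 y0 c1 c2 c3 c4,
      [/\ x1 = c1 * x0 /\ y1 = c1 * y0, x2 = c2 * x0 /\ y2 = c2 * y0,
        x3 = c3 * x0 /\ y3 = c3 * y0 & x4 = c4 * x0 /\ y4 = c4 * y0]].
Proof.
move=> H.
have H' s t : (x1 * s + y1 * t) ^+ 3 + (x2 * s + y2 * t) ^+ 3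
       - ((x3 * s + y3 * t) ^+ 3 + (x4 * s + y4 * t) ^+ 3) = 0.
  by rewrite H subrr.
have HN x y s t : (- x * s + - y * t) ^+ 3 = - (x * s + y * t) ^+ 3 by ring.
(* The six pairs are tested in turn. An independent pair is brought to one side of the equation,
   with sign changes absorbed into the cubes; only if all six minors vanish does the collinear case
   remain. *)
have [e12|n12] := eqVneq (x1 * y2) (x2 * y1); last first.
  by case: (sum_two_cubes_indep n12 H) => h; [apply: Or41 | apply: Or42].
have nN x y x' y' : x * y' != x' * y -> x * - y' != - x' * y.
  by rewrite mulrN mulNr eqr_opp.
have [e13|/nN n13] := eqVneq (x1 * y3) (x3 * y1); last first.
  case: (@sum_two_cubes_indep _ _ _ _ (- x2) (- y2) x4 y4 n13) => [s t|h|].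
  - by apply/eqP; rewrite -subr_eq0 -(H' s t) !HN; apply/eqP; ring.
  - by apply: Or43.
  by case=> h /cube_assocNN/cube_assoc_sym h'; apply: Or42; split=> //;
     apply: cube_assoc_sym.
have [e14|/nN n14] := eqVneq (x1 * y4) (x4 * y1); last first.
  case: (@sum_two_cubes_indep _ _ _ _ (- x2) (- y2) x3 y3 n14) => [s t| |].
  - by apply/eqP; rewrite -subr_eq0 -(H' s t) !HN; apply/eqP; ring.
  - by case=> h /cube_assocN/cube_assoc_sym h'; apply: Or43.
  by case=> h /cube_assocNN/cube_assoc_sym h'; apply: Or41.
have [e23|/nN n23] := eqVneq (x2 * y3) (x3 * y2); last first.
  case: (@sum_two_cubes_indep _ _ _ _ (- x1) (- y1) x4 y4 n23) => [s t| |].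
  - by apply/eqP; rewrite -subr_eq0 -(H' s t) !HN; apply/eqP; ring.
  - by case=> /cube_assocN/cube_assoc_sym h h'; apply: Or43.
  by case=> /cube_assoc_sym h /cube_assocNN h'; apply: Or41.
have [e24|/nN n24] := eqVneq (x2 * y4) (x4 * y2); last first.
  case: (@sum_two_cubes_indep _ _ _ _ (- x1) (- y1) x3 y3 n24) => [s t| |].
  - by apply/eqP; rewrite -subr_eq0 -(H' s t) !HN; apply/eqP; ring.
  - by case=> /cube_assocN/cube_assoc_sym h /cube_assocN/cube_assoc_sym h';
       apply: Or43.
  by case=> /cube_assoc_sym h /cube_assocNN h'; apply: Or42.
have [e34|n34] := eqVneq (x3 * y4) (x4 * y3); last first.
  case: (@sum_two_cubes_indep _ _ _ _ x1 y1 x2 y2 n34) => [s t|[]|[]].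
  - by rewrite H.
  - by move=> /cube_assoc_sym h /cube_assoc_sym h'; apply: Or41.
  by move=> h h'; apply: Or42.
apply: Or44.
pose x (i : 'I_4) := nth 0 [:: x1; x2; x3; x4] i.
pose y (i : 'I_4) := nth 0 [:: y1; y2; y3; y4] i.
have [|x0 [y0 [c hc]]] := @collinear_vectors _ x y.
  by case=> [[|[|[|[|?]]]] ?] [[|[|[|[|?]]]] ?] //; rewrite /x /y /= //
    -?e12 -?e13 -?e14 -?e23 -?e24 -?e34.
exists x0, y0, (c (inord 0)), (c (inord 1)), (c (inord 2)), (c (inord 3)).
by split; [have := hc (inord 0) | have := hc (inord 1) | have := hc (inord 2)
  | have := hc (inord 3)]; rewrite /x /y inordK.
Qed.

End LinearCubes.

(** * Binary forms: independence, and the plane section cut out by the linear relation *)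

Section BinaryForms.
Variable C : numClosedFieldType.
Implicit Types f g h : {mpoly C[2]}.

Definition quad (a b c : C) : {mpoly C[2]} :=
  a *: X C ^+ 2 + b *: (X C * Y C) + c *: Y C ^+ 2.

Lemma quadD a b c a' b' c' :
  quad a b c + quad a' b' c' = quad (a + a') (b + b') (c + c').
Proof. by rewrite /quad !scalerDl addrACA (addrACA (a *: _)). Qed.

Lemma quadZ k a b c : k *: quad a b c = quad (k * a) (k * b) (k * c).
Proof. by rewrite /quad !scalerDr !scalerA. Qed.

Lemma quadN a b c : - quad a b c = quad (- a) (- b) (- c).
Proof. by rewrite -scaleN1r quadZ !mulN1r. Qed.

Lemma dhomog2_quad f : f \is 2.-homog -> exists a b c, f = quad a b c.
Proof.
move=> hf; pose u0 := mnm1 (0 : 'I_2); pose u1 := mnm1 (1 : 'I_2).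
exists f@_(u0 + u0), f@_(u0 + u1), f@_(u1 + u1); apply/mpolyP => m.
rewrite /quad /X /Y !expr2 -!mpolyXD !mcoeffD !mcoeffZ !mcoeffX.
have em (n : 'X_{1.. 2}) : (n == m) = (n 0 == m 0) && (n 1 == m 1).
  apply/eqP/andP => [-> | [/eqP e0 /eqP e1]]; first by rewrite !eqxx.
  by apply/mnmP => [[[|[|?]] lt]] //; [have := e0 | have := e1];
    congr (_ = _); congr (fun_of_multinom _ _); apply: val_inj.
rewrite !em !mnmDE !mnm1E /=.
have dm : mdeg m = (m 0%R + m 1%R)%N.
  rewrite mdegE !big_ord_recl big_ord0 addn0.
  by congr (m _ + m _)%N; apply: val_inj.
have [d2|d2] := eqVneq (mdeg m) 2%N; last first.
  have F (i j : nat) : (i + j = 2)%N -> (i == m 0) && (j == m 1) = false.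
    move=> e; apply: contraNF d2 => /andP[/eqP e0 /eqP e1].
    by rewrite dm -e0 -e1 e.
  by rewrite (dhomog_nemf_coeff hf d2) !F //= !mulr0 !addr0.
have eqm (n : 'X_{1.. 2}) : n 0 = m 0 -> n 1 = m 1 -> f@_m = f@_n.
  by move=> e0 e1; congr (f@_ _); apply/esym/eqP; rewrite em e0 e1 !eqxx.
have : [\/ m 0 = 2%N /\ m 1 = 0%N, m 0 = 1%N /\ m 1 = 1%N
         | m 0 = 0%N /\ m 1 = 2%N].
  rewrite dm in d2; move: (m 0) (m 1) d2 => a b.
  case: a b => [|[|[|?]]] [|[|[|?]]] //= _;
    by [apply: Or31 | apply: Or32 | apply: Or33].
case=> -[e0 e1]; rewrite e0 e1 /= !(mulr0, mulr1, addr0, add0r);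
  by apply: eqm; rewrite ?e0 ?e1 !mnmDE !mnm1E.
Qed.

Definition point (x y : C) (i : 'I_2) : C := if i == 0 then x else y.

Lemma quad_eval a b c x y :
  (quad a b c).@[point x y] = a * x ^+ 2 + b * (x * y) + c * y ^+ 2.
Proof.
by rewrite /quad !mevalD !mevalZ !rmorphM /= /X /Y !mevalXU /point /= !expr2.
Qed.

Lemma proportional_multiples f g h k k' :
  f = k *: h -> g = k' *: h -> proportional f g.
Proof.
move=> -> ->; have [->|k0] := eqVneq k 0.
  have [->|k'0] := eqVneq k' 0.
    by exists 1, 1; rewrite !scale0r !scaler0 xpair_eqE oner_eq0.
  by exists 1, 0; rewrite !scale0r scaler0 xpair_eqE oner_eq0.
by exists k', k; rewrite !scalerA mulrC xpair_eqE negb_and k0 orbT.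
Qed.

Lemma proportional_sym f g : proportional f g -> proportional g f.
Proof.
by case=> a [b [ab e]]; exists b, a; rewrite e; split=> //;
  move: ab; rewrite !xpair_eqE andbC.
Qed.

Lemma nonproportional_neq0 f g : ~ proportional f g -> g != 0.
Proof.
move=> h; apply/eqP=> g0; apply: h; exists 0, 1.
by rewrite g0 scaler0 scale0r xpair_eqE oner_eq0 andbF.
Qed.

Lemma nonproportional_sub f g r : ~ proportional f g -> f - r *: g != 0.
Proof.
move=> h; apply/eqP=> e; apply: h; exists 1, r.
by rewrite xpair_eqE oner_eq0 scale1r; split=> //; apply/eqP; rewrite -subr_eq0 e.
Qed.

Lemma proportionalZ f g r s :
  r != 0 -> s != 0 -> proportional (r *: f) (s *: g) -> proportional f g.
Proof.
move=> r0 s0 [a [b [ab]]]; rewrite !scalerA => e; exists (a * r), (b * s).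
by split=> //; move: ab; rewrite !xpair_eqE !mulf_eq0 (negbTE r0) (negbTE s0) !orbF.
Qed.

(** The sum is the homogenization of [p] evaluated at ([f], [g]). Over an algebraically closed field
    it splits into factors [f - r *: g] and [g], none of which is zero, in an integral domain. *)
Lemma forms_alg_indep f g n (p : {poly C}) :
  ~ proportional f g -> (size p <= n.+1)%N ->
  \sum_(i < n.+1) p`_i *: (f ^+ i * g ^+ (n - i)) = 0 -> p = 0.
Proof.
move=> hfg; elim: n p => [|n IHn] p sp.
  rewrite big_ord1 !expr0 mulr1 => /eqP.
  rewrite scaler_eq0 oner_eq0 orbF => /eqP p0.
  by rewrite (size1_polyC sp) p0.
(* If the top coefficient vanishes, every remaining term contains [g], which is cancelled. *)
have [sp1 | sp1] := leqP (size p) n.+1.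
  rewrite big_ord_recr /= nth_default // scale0r addr0 => h.
  apply: IHn => //; apply: (mulfI (nonproportional_neq0 hfg)).
  rewrite mulr0 -[RHS]h mulr_sumr; apply: eq_bigr => i _.
  by rewrite -scalerAr mulrCA -exprS subSn // -ltnS.
have [r /factor_theorem [q eq]] : exists r, root p r.
  by apply/closed_rootP; rewrite gtn_eqF // (leq_trans _ sp1).
have q0 : q != 0.
  by apply: contraTneq sp1 => q0; rewrite eq q0 mul0r size_poly0.
have sq : (size q <= n.+1)%N.
  by move: sp; rewrite eq size_Mmonic ?monicXsubC // size_XsubC addn2.
have ecoef i : p`_i = (if i == 0%N then 0 else q`_i.-1) - r * q`_i.
  by rewrite eq mulrBr coefB coefMX coefMC mulrC.
(* The factor X - r of [p] becomes the factor [f - r *: g] of the sum. *)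
move=> h; have : (f - r *: g) * \sum_(i < n.+1) q`_i *: (f ^+ i * g ^+ (n - i)) = 0.
  rewrite -[RHS]h mulrBl.
  under [RHS]eq_bigr => i _ do rewrite ecoef scalerBl.
  rewrite sumrB; congr (_ - _).
    rewrite [RHS]big_ord_recl /= scale0r add0r mulr_sumr; apply: eq_bigr => i _.
    by rewrite -scalerAr mulrA -exprS /= /bump /= add1n subSS.
  rewrite [RHS]big_ord_recr /= nth_default // mulr0 scale0r addr0 mulr_sumr.
  apply: eq_bigr => i _.
  by rewrite -scalerAl -scalerAr scalerA mulrCA -exprS subSn // -ltnS.
move/eqP; rewrite mulf_eq0 (negbTE (nonproportional_sub r hfg)) /= => /eqP.
by move/(IHn _ sq) => q00; rewrite q00 eqxx in q0.
Qed.

Lemma cubic_forms_indep f g (e0 e1 e2 e3 : C) :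
  ~ proportional f g ->
  e0 *: f ^+ 3 + e1 *: (f ^+ 2 * g) + e2 *: (f * g ^+ 2) + e3 *: g ^+ 3 = 0 ->
  [/\ e0 = 0, e1 = 0, e2 = 0 & e3 = 0].
Proof.
move=> hfg h.
(* The polynomial lists coefficients by increasing power of [f], hence the reversed order. *)
have /(@forms_alg_indep f g 3 (Poly [:: e3; e2; e1; e0]) hfg) p0 :
  (size (Poly [:: e3; e2; e1; e0]) <= 4)%N by apply: size_Poly.
have rev4 (V : zmodType) (a b c d : V) : a + (b + (c + d)) = d + c + b + a.
  by rewrite addrC [b + _]addrC [c + _]addrC.
have pi i : [:: e3; e2; e1; e0]`_i = 0.
  rewrite -coef_Poly p0 ?coef0 // !big_ord_recl big_ord0 !coef_Poly /= -[RHS]h.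
  rewrite !expr0 mul1r mulr1 !expr1 addr0 /bump /=.
  by rewrite rev4.
by split; [have := pi 3 | have := pi 2 | have := pi 1 | have := pi 0].
Qed.

(** In characteristic zero 0, ..., 6 are seven distinct roots of a polynomial of degree at most
    six. *)
Lemma sextic_coefs_eq0 (c0 c1 c2 c3 c4 c5 c6 : C) :
  (forall t, c6 * t ^+ 6 + c5 * t ^+ 5 + c4 * t ^+ 4 + c3 * t ^+ 3
     + c2 * t ^+ 2 + c1 * t + c0 = 0) ->
  [/\ c6 = 0, c5 = 0 & c4 = 0] /\ [/\ c3 = 0, c2 = 0, c1 = 0 & c0 = 0].
Proof.
move=> h; pose s := [:: c0; c1; c2; c3; c4; c5; c6].
have p0 : Poly s = 0.
  apply: (@roots_geq_poly_eq0 _ _ [seq i%:R | i <- iota 0 7]).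
  - apply/allP=> t _; rewrite /root horner_Poly /= -[X in _ == X](h t).
    by apply/eqP; ring.
  - by rewrite map_inj_uniq ?iota_uniq // => i j /eqP; rewrite eqr_nat => /eqP.
  - by rewrite size_map size_iota; apply: size_Poly.
have si i : s`_i = 0 by rewrite -coef_Poly p0 coef0.
by split; split; [have := si 6 | have := si 5 | have := si 4 | have := si 3
  | have := si 2 | have := si 1%N | have := si 0%N].
Qed.

(* The cubic forms in A, B, D vanishing at (x^2, xy, y^2) are the multiples of
   A D - B^2. *)
Lemma conic_residual_line a1 b1 c1 a2 b2 c2 a3 b3 c3 a4 b4 c4 :
  quad a1 b1 c1 ^+ 3 + quad a2 b2 c2 ^+ 3
    = quad a3 b3 c3 ^+ 3 + quad a4 b4 c4 ^+ 3 ->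
  exists p q r, forall A B D : C,
    (a1 * A + b1 * B + c1 * D) ^+ 3 + (a2 * A + b2 * B + c2 * D) ^+ 3
    - ((a3 * A + b3 * B + c3 * D) ^+ 3 + (a4 * A + b4 * B + c4 * D) ^+ 3)
    = (A * D - B ^+ 2) * (p * A + q * B + r * D).
Proof.
move=> h.
pose S (F : C -> C -> C -> C) := F a1 b1 c1 + F a2 b2 c2 - (F a3 b3 c3 + F a4 b4 c4).
(* These are the coefficients of the sextic in [t] obtained on the conic at A = t^2, B = t, D =
   1. *)
pose k6 := S (fun a b c => a ^+ 3).
pose k5 := S (fun a b c => 3 * a ^+ 2 * b).
pose k4 := S (fun a b c => 3 * (a ^+ 2 * c + a * b ^+ 2)).
pose k3 := S (fun a b c => 6 * a * b * c + b ^+ 3).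
pose k2 := S (fun a b c => 3 * (a * c ^+ 2 + b ^+ 2 * c)).
pose k1 := S (fun a b c => 3 * b * c ^+ 2).
pose k0 := S (fun a b c => c ^+ 3).
have [|[z6 z5 z4] [z3 z2 z1 z0]] := @sextic_coefs_eq0 k0 k1 k2 k3 k4 k5 k6.
  move=> t; have := congr1 (meval (point t 1)) h.
  rewrite !rmorphD !rmorphXn /= !quad_eval => /eqP.
  rewrite -subr_eq0 => /eqP e; rewrite -[RHS]e.
  by rewrite /k6 /k5 /k4 /k3 /k2 /k1 /k0 /S; ring.
(* The line is read off from the coefficients of A^2 D, A B D and A D^2 in the cubic, to which B^2
   times the line does not contribute. *)
exists (S (fun a b c => 3 * a ^+ 2 * c)), (S (fun a b c => 6 * a * b * c)),
  (S (fun a b c => 3 * a * c ^+ 2)) => A B D.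
apply/eqP; rewrite -subr_eq0; apply/eqP.
transitivity (k6 * A ^+ 3 + k5 * (A ^+ 2 * B) + k4 * (A * B ^+ 2) + k3 * B ^+ 3
  + k2 * (B ^+ 2 * D) + k1 * (B * D ^+ 2) + k0 * D ^+ 3).
  by rewrite /k6 /k5 /k4 /k3 /k2 /k1 /k0 /S; ring.
by rewrite z6 z5 z4 z3 z2 z1 z0; ring.
Qed.

(* E, E', N come from the basis dual to one of C^3 whose first two vectors span
   the plane p A + q B + r D = 0; x, y are the coordinates on E, E'. *)
Lemma plane_basis p q r : exists (E E' N : {mpoly C[2]}) (x y : C -> C -> C -> C),
  [/\ forall a b c, exists z, quad a b c = x a b c *: E + y a b c *: E' + z *: N
    & forall s t, exists A B D, p * A + q * B + r * D = 0 /\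
        forall a b c, a * A + b * B + c * D = x a b c * s + y a b c * t].
Proof.
have [p0|p0] := eqVneq p 0; last first.
  exists (quad 0 p^-1 0), (quad 0 0 p^-1), (quad 1 (q / p) (r / p)).
  exists (fun a b c => p * b - q * a), (fun a b c => p * c - r * a).
  split=> [a b c | s t].
    by exists a; rewrite !quadZ !quadD; congr quad; field.
  by exists (- q * s - r * t), (p * s), (p * t); split=> [|a b c]; ring.
have [q0|q0] := eqVneq q 0; last first.
  exists (quad 1 0 0), (quad 0 0 q^-1), (quad 0 1 (r / q)).
  exists (fun a b c => a), (fun a b c => q * c - r * b).
  split=> [a b c | s t].
    by exists b; rewrite !quadZ !quadD; congr quad; field.
  by exists s, (- r * t), (q * t); rewrite p0; split=> [|a b c]; ring.
(* Here [p] and [q] vanish, and D = 0 satisfies the relation whatever [r] is, so the zero relation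
   is covered too. *)
exists (quad 1 0 0), (quad 0 1 0), (quad 0 0 1).
exists (fun a b c => a), (fun a b c => b).
split=> [a b c | s t].
  by exists c; rewrite !quadZ !quadD; congr quad; ring.
by exists s, t, 0; rewrite p0 q0; split=> [|a b c]; ring.
Qed.

End BinaryForms.

(** * From the residual line to a linear relation between the forms *)

Section Pairing.
Variable C : numClosedFieldType.
Implicit Types f g h G N : {mpoly C[2]}.

Lemma proportionalN f g : proportional f (- g) -> proportional f g.
Proof.
case=> a [b [ab e]]; exists a, (- b); rewrite scaleNr -scalerN; split=> //.
by move: ab; rewrite !xpair_eqE oppr_eq0.
Qed.

(** If [G] and [N] were proportional, their span would have dimension at most one, making [f] and
    [g] proportional. *)
Lemma nonproportional_basis f g c d c' d' G N :
  f = c *: G + d *: N -> g = c' *: G + d' *: N ->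
  ~ proportional f g -> ~ proportional G N.
Proof.
move=> ef eg h [a [b []]]; rewrite xpair_eqE negb_and => ab e; apply: h.
have [b0|b0] := eqVneq b 0.
  have a0 : a != 0 by move: ab; rewrite b0 eqxx orbF.
  have G0 : G = 0.
    by move/eqP: e; rewrite b0 scale0r scaler_eq0 (negbTE a0) => /eqP.
  by apply: (proportional_multiples (h := N) (k := d) (k' := d'));
    rewrite ?ef ?eg G0 scaler0 add0r.
have eN : N = (a / b) *: G.
  by apply: (scalerI b0); rewrite -e scalerA mulrCA mulfV // mulr1.
by apply: (proportional_multiples (h := G) (k := c + d * (a / b))
  (k' := c' + d' * (a / b))); rewrite ?ef ?eg eN scalerA -scalerDl.
Qed.

(** The morphism [phi] lets one expansion serve both for polynomials, with scalars embedded as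
    constants, and for the scalars themselves. *)
Lemma expand_sum_cubes (A : comNzRingType) (phi : {rmorphism C -> A}) (G N : A)
    (c1 z1 c2 z2 c3 z3 c4 z4 : C) :
  phi (c1 ^+ 3 + c2 ^+ 3 - (c3 ^+ 3 + c4 ^+ 3)) * G ^+ 3
  + phi (3 * (c1 ^+ 2 * z1 + c2 ^+ 2 * z2 - (c3 ^+ 2 * z3 + c4 ^+ 2 * z4)))
    * (G ^+ 2 * N)
  + phi (3 * (c1 * z1 ^+ 2 + c2 * z2 ^+ 2 - (c3 * z3 ^+ 2 + c4 * z4 ^+ 2)))
    * (G * N ^+ 2)
  + phi (z1 ^+ 3 + z2 ^+ 3 - (z3 ^+ 3 + z4 ^+ 3)) * N ^+ 3
  = (phi c1 * G + phi z1 * N) ^+ 3 + (phi c2 * G + phi z2 * N) ^+ 3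
    - ((phi c3 * G + phi z3 * N) ^+ 3 + (phi c4 * G + phi z4 * N) ^+ 3).
Proof. ring. Qed.

(** In a pencil the relation holds already between the coordinate vectors, since the cubic monomials
    in [G] and [N] are independent; each outcome of [four_linear_cubes] then makes [f1] proportional
    to another form. *)
Lemma sum_cubes_pencil f1 f2 f3 f4 G N c1 z1 c2 z2 c3 z3 c4 z4 :
  f1 = c1 *: G + z1 *: N -> f2 = c2 *: G + z2 *: N ->
  f3 = c3 *: G + z3 *: N -> f4 = c4 *: G + z4 *: N ->
  ~ proportional f1 f2 -> ~ proportional f1 f3 -> ~ proportional f1 f4 ->
  f1 ^+ 3 + f2 ^+ 3 <> f3 ^+ 3 + f4 ^+ 3.
Proof.
move=> e1 e2 e3 e4 h12 h13 h14 hsum.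
have hGN := nonproportional_basis e1 e2 h12.
have /eqP := hsum; rewrite -subr_eq0 e1 e2 e3 e4 -!mul_mpolyC.
rewrite -expand_sum_cubes !mul_mpolyC => /eqP /(cubic_forms_indep hGN).
case=> k0 k1 k2 k3.
have H s t : (c1 * s + z1 * t) ^+ 3 + (c2 * s + z2 * t) ^+ 3
   = (c3 * s + z3 * t) ^+ 3 + (c4 * s + z4 * t) ^+ 3.
  apply/eqP; rewrite -subr_eq0; apply/eqP.
  rewrite -(expand_sum_cubes idfun) /= k0 k1 k2 k3.
  by rewrite !mul0r !addr0.
have prop f g c z c' z' : f = c *: G + z *: N -> g = c' *: G + z' *: N ->
    cube_assoc c z c' z' -> proportional f g.
  move=> -> -> [r _ [-> ->]]; rewrite -!scalerA -scalerDr.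
  by apply: (@proportional_multiples _ _ _ (c' *: G + z' *: N) r 1);
    rewrite ?scale1r.
case: (four_linear_cubes H) => [[h _]|[h _]|[h _]|].
- exact: h13 (prop _ _ _ _ _ _ e1 e3 h).
- exact: h14 (prop _ _ _ _ _ _ e1 e4 h).
- apply: h12; apply: proportionalN.
  by apply: (prop _ _ _ _ _ _ e1 _ h); rewrite e2 opprD -!scaleNr.
case=> [x0 [y0 [d1 [d2 [_ [_ [[a1 b1] [a2 b2] _ _]]]]]]].
apply: h12; apply: (@proportional_multiples _ _ _ (x0 *: G + y0 *: N) d1 d2).
  by rewrite e1 a1 b1 scalerDr !scalerA.
by rewrite e2 a2 b2 scalerDr !scalerA.
Qed.

(* The four forms satisfy the linear relation cut out by a plane through one of
   the nine lines (u1 = r u3, u4 = s u2) of the cubic surface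
   u1^3 + u2^3 = u3^3 + u4^3. *)
Definition matched (h1 h2 h3 h4 : {mpoly C[2]}) :=
  exists r s t : C, [/\ r ^+ 3 = 1, s ^+ 3 = 1, t != 0 &
                        h1 - r *: h3 = t *: (h4 - s *: h2)].

(** Subtracting the right cube-root multiple kills the [E] and [E'] parts, so both differences are
    multiples of [N]. They are nonzero by nonproportionality, and their ratio is the required
    [t]. *)
Lemma matched_of_cube_assoc E E' N g1 g2 g3 g4
    (u1 v1 z1 u2 v2 z2 u3 v3 z3 u4 v4 z4 : C) :
  g1 = u1 *: E + v1 *: E' + z1 *: N -> g2 = u2 *: E + v2 *: E' + z2 *: N ->
  g3 = u3 *: E + v3 *: E' + z3 *: N -> g4 = u4 *: E + v4 *: E' + z4 *: N ->
  ~ proportional g1 g3 -> ~ proportional g2 g4 ->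
  cube_assoc u1 v1 u3 v3 -> cube_assoc u4 v4 u2 v2 -> matched g1 g2 g3 g4.
Proof.
have diff f g (u v z u' v' z' : C) : f = u *: E + v *: E' + z *: N ->
    g = u' *: E + v' *: E' + z' *: N -> cube_assoc u v u' v' ->
    exists r, r ^+ 3 = 1 /\ exists k, f - r *: g = k *: N.
  move=> -> -> [w hw [-> ->]]; exists w; split=> //; exists (z - w * z').
  by rewrite !scalerDr !scalerA scalerBl opprD addrACA subrr add0r.
move=> d1 d2 d3 d4 n13 n24 m13 m42.
have [w [hw [k hk]]] := diff _ _ _ _ _ _ _ _ d1 d3 m13.
have [w' [hw' [k' hk']]] := diff _ _ _ _ _ _ _ _ d4 d2 m42.
have n42 : ~ proportional g4 g2 by move/proportional_sym.
have := nonproportional_sub w n13; have := nonproportional_sub w' n42.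
rewrite hk hk' !scaler_eq0 !negb_or => /andP[k'0 _] /andP[k0 _].
exists w, w', (k / k'); rewrite hk hk' mulf_neq0 ?invr_neq0 //.
by split=> //; rewrite scalerA divfK.
Qed.

(** On the plane of the residual line the sums of cubes agree identically, so the coordinates on
    [E], [E'] give four linear forms to which [four_linear_cubes] applies. *)
Lemma sum_cubes_matched f1 f2 f3 f4 :
  f1 \is 2.-homog -> f2 \is 2.-homog -> f3 \is 2.-homog -> f4 \is 2.-homog ->
  ~ proportional f1 f2 -> ~ proportional f1 f3 -> ~ proportional f1 f4 ->
  ~ proportional f2 f3 -> ~ proportional f2 f4 -> ~ proportional f3 f4 ->
  f1 ^+ 3 + f2 ^+ 3 = f3 ^+ 3 + f4 ^+ 3 ->
  [\/ matched f1 f2 f3 f4, matched f1 f2 f4 f3 | matched f1 (- f3) (- f2) f4].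
Proof.
move=> /dhomog2_quad [a1 [b1 [c1 e1]]] /dhomog2_quad [a2 [b2 [c2 e2]]].
move=> /dhomog2_quad [a3 [b3 [c3 e3]]] /dhomog2_quad [a4 [b4 [c4 e4]]].
move=> h12 h13 h14 h23 h24 h34 hsum.
have hsum' := hsum; rewrite e1 e2 e3 e4 in hsum'.
have [p [q [r hL]]] := conic_residual_line hsum'.
have [E [E' [N [x [y [hq hW]]]]]] := plane_basis p q r.
have [z1 q1] := hq a1 b1 c1; have [z2 q2] := hq a2 b2 c2.
have [z3 q3] := hq a3 b3 c3; have [z4 q4] := hq a4 b4 c4.
rewrite -e1 in q1; rewrite -e2 in q2; rewrite -e3 in q3; rewrite -e4 in q4.
have H s t : (x a1 b1 c1 * s + y a1 b1 c1 * t) ^+ 3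
   + (x a2 b2 c2 * s + y a2 b2 c2 * t) ^+ 3
   = (x a3 b3 c3 * s + y a3 b3 c3 * t) ^+ 3
     + (x a4 b4 c4 * s + y a4 b4 c4 * t) ^+ 3.
  have [A [B [D [h0 hlin]]]] := hW s t.
  by apply/eqP; rewrite -subr_eq0 -!hlin hL h0 mulr0.
have negE f u v z : f = u *: E + v *: E' + z *: N ->
    - f = (- u) *: E + (- v) *: E' + (- z) *: N.
  by move=> ->; rewrite !scaleNr !opprD.
case: (four_linear_cubes H) => [[m m']|[m m']|[m m']|].
- by apply: Or31; apply: (matched_of_cube_assoc q1 q2 q3 q4).
- by apply: Or32; apply: (matched_of_cube_assoc q1 q2 q4 q3).
(* The third pairing is the first one after [f2] and [f3] change sides. *)
- apply: Or33.
  apply: (matched_of_cube_assoc q1 (negE _ _ _ _ q3) (negE _ _ _ _ q2) q4 _ _ m m').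
    by move/proportionalN.
  by move/proportional_sym/proportionalN/proportional_sym; apply: h34.
case=> [x0 [y0 [d1 [d2 [d3 [d4 [[u1 v1] [u2 v2] [u3 v3] [u4 v4]]]]]]]].
(* In the collinear case all four forms lie in the pencil of [G] and [N], which is excluded. *)
pose G := x0 *: E + y0 *: E'.
have GE f u v z d : f = u *: E + v *: E' + z *: N -> u = d * x0 -> v = d * y0 ->
    f = d *: G + z *: N.
  by move=> -> -> ->; rewrite /G scalerDr !scalerA.
by case: (sum_cubes_pencil (GE _ _ _ _ _ q1 u1 v1) (GE _ _ _ _ _ q2 u2 v2)
  (GE _ _ _ _ _ q3 u3 v3) (GE _ _ _ _ _ q4 u4 v4)).
Qed.

End Pairing.

(** * Quadratic forms whose product is a multiple of a square *)

Section NormalForm.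
Variable C : numClosedFieldType.
Implicit Types f g h u v s : {mpoly C[2]}.

Definition lin (p q : C) : {mpoly C[2]} := p *: X C + q *: Y C.

Lemma linM p q p' q' :
  lin p q * lin p' q' = quad (p * p') (p * q' + q * p') (q * q').
Proof.
rewrite /lin /quad mulrDl !mulrDr -!scalerAl -!scalerAr !scalerA !expr2.
by rewrite [Y C * X C]mulrC scalerDl !addrA.
Qed.

Lemma linZ k p q : k *: lin p q = lin (k * p) (k * q).
Proof. by rewrite /lin scalerDr !scalerA. Qed.

Lemma quad_factor a b c :
  exists p q p' q', quad a b c = lin p q * lin p' q'.
Proof.
have [a0|a0] := eqVneq a 0.
  by exists 0, 1, b, c; rewrite linM a0; congr quad; ring.
(* Quadratic formula, with [r] a square root of the discriminant and the leading coefficient kept in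
   the first factor. *)
pose r := sqrtC (b ^+ 2 - 4 * a * c).
have hr : r ^+ 2 = b ^+ 2 - 4 * a * c by rewrite sqrtCK.
have two : (2 : C) != 0 by rewrite pnatr_eq0.
exists a, ((b - r) / 2), 1, ((b + r) / (2 * a)); rewrite linM.
congr quad; first by ring.
  by field; rewrite a0.
transitivity ((b ^+ 2 - r ^+ 2) / (4 * a)); last by field; rewrite a0.
by rewrite hr; field.
Qed.

Lemma lin_dependent p q p' q' : p * q' = q * p' ->
  exists (k k' a b : C), lin p q = k *: lin a b /\ lin p' q' = k' *: lin a b.
Proof.
move=> h; have [p0|p0] := eqVneq p 0; last first.
  exists 1, (p' / p), p, q; rewrite scale1r linZ divfK //; split=> //.
  by congr lin; apply: (mulfI p0); rewrite h; field.
have [q0|q0] := eqVneq q 0.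
  by exists 0, 1, p', q'; rewrite p0 q0 !linZ !mul0r !mul1r.
exists 1, (q' / q), p, q; rewrite scale1r linZ divfK //; split=> //.
congr lin; move/eqP: h; rewrite p0 mul0r eq_sym mulf_eq0 (negbTE q0) => /eqP ->.
by rewrite mulr0.
Qed.

Lemma lin_eval p q x y : (lin p q).@[point x y] = p * x + q * y.
Proof. by rewrite /lin mevalD !mevalZ /X /Y !mevalXU. Qed.

(** The hypotheses say that the quadratic vanishes at (q, -p) and (q', -p'), the distinct zeros of
    the two linear forms; this determines it up to a scalar. *)
Lemma vanish_at_roots_proportional p q p' q' a b c :
  p * q' != q * p' ->
  a * q ^+ 2 - b * (q * p) + c * p ^+ 2 = 0 ->
  a * q' ^+ 2 - b * (q' * p') + c * p' ^+ 2 = 0 ->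
  proportional (lin p q * lin p' q') (quad a b c).
Proof.
rewrite -subr_eq0 => D0 h h'.
(* Ratio of the polar forms of the two quadratics at this pair of zeros; the polar form of the
   product of linear forms there is the denominator. *)
pose k := (a * (q * q') * 2 - b * (p * q' + q * p') + c * (p * p') * 2)
          / (- (p * q' - q * p') ^+ 2).
have ND0 : - (p * q' - q * p') ^+ 2 != 0 by rewrite oppr_eq0 expf_neq0.
apply: (@proportional_multiples _ _ _ (lin p q * lin p' q') 1 k).
  by rewrite scale1r.
rewrite linM quadZ.
congr quad; rewrite /k mulrAC; apply: (canRL (mulfK ND0)); apply/eqP;
  rewrite -subr_eq0; apply/eqP.
- transitivity (- p' ^+ 2 * (a * q ^+ 2 - b * (q * p) + c * p ^+ 2)
   - p ^+ 2 * (a * q' ^+ 2 - b * (q' * p') + c * p' ^+ 2)); first by ring.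
  by rewrite h h' !mulr0 subr0.
- transitivity (- 2 * (p' * q') * (a * q ^+ 2 - b * (q * p) + c * p ^+ 2)
   - 2 * (p * q) * (a * q' ^+ 2 - b * (q' * p') + c * p' ^+ 2)); first by ring.
  by rewrite h h' !mulr0 subr0.
- transitivity (- q' ^+ 2 * (a * q ^+ 2 - b * (q * p) + c * p ^+ 2)
   - q ^+ 2 * (a * q' ^+ 2 - b * (q' * p') + c * p' ^+ 2)); first by ring.
  by rewrite h h' !mulr0 subr0.
Qed.

(** Factor [u] into linear forms. If they are dependent, [u] is a square; otherwise [s] vanishes at
    both zeros of [u] and is proportional to it. *)
Lemma divides_square_proportional_or_square u v s (c : C) :
  u \is 2.-homog -> s \is 2.-homog -> c != 0 -> u * v = c *: s ^+ 2 ->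
  ~ proportional u s -> exists p q, u = lin p q ^+ 2.
Proof.
move=> /dhomog2_quad [u0 [u1 [u2 ->]]] /dhomog2_quad [s0 [s1 [s2 ->]]] c0.
have [p [q [p' [q' ->]]]] := quad_factor u0 u1 u2.
move=> h n; have [e|D0] := eqVneq (p * q') (q * p').
  have [k [k' [a [b [-> ->]]]]] := lin_dependent e.
  exists (sqrtC (k * k') * a), (sqrtC (k * k') * b).
  by rewrite -linZ exprZn sqrtCK -scalerAl -scalerAr scalerA expr2.
case: n; apply: vanish_at_roots_proportional D0 _ _.
  have /eqP := congr1 (meval (point q (- p))) h.
  rewrite !rmorphM /= !lin_eval [p * q]mulrC mulrN subrr !mul0r.
  rewrite mevalZ rmorphXn /= quad_eval eq_sym mulf_eq0 (negbTE c0) expf_eq0 /=.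
  by move/eqP => <-; ring.
have /eqP := congr1 (meval (point q' (- p'))) h.
rewrite !rmorphM /= !lin_eval [p' * q']mulrC !mulrN subrr mulr0 !mul0r.
rewrite mevalZ rmorphXn /= quad_eval eq_sym mulf_eq0 (negbTE c0) expf_eq0 /=.
by move/eqP => <-; ring.
Qed.

Lemma mul_eq_square u v s (c : C) :
  u \is 2.-homog -> v \is 2.-homog -> s \is 2.-homog -> c != 0 ->
  u * v = c *: s ^+ 2 -> ~ proportional u s -> ~ proportional v s ->
  exists p q p' q' k, [/\ p * q' - q * p' != 0, k ^+ 2 = c,
    u = lin p q ^+ 2, v = lin p' q' ^+ 2 & k *: s = lin p q * lin p' q'].
Proof.
move=> hu hv hs c0 h nu nv.
have [p [q eu]] := divides_square_proportional_or_square hu hs c0 h nu.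
have h' : v * u = c *: s ^+ 2 by rewrite mulrC.
have [p' [q' ev]] := divides_square_proportional_or_square hv hs c0 h' nv.
pose k0 := sqrtC c; have k02 : k0 ^+ 2 = c by rewrite sqrtCK.
(* A difference of squares determines the product of the linear forms up to sign; the sign is
   absorbed into the square root [k] of [c]. *)
have [k hk ek] : exists2 k, k ^+ 2 = c & k *: s = lin p q * lin p' q'.
  have : (k0 *: s - lin p q * lin p' q') * (k0 *: s + lin p q * lin p' q') = 0.
    by rewrite -subr_sqr exprZn k02 -h eu ev exprMn subrr.
  move/eqP; rewrite mulf_eq0 => /orP [|].
    by rewrite subr_eq0 => /eqP e; exists k0.
  by rewrite addr_eq0 => /eqP e; exists (- k0); rewrite ?sqrrN // scaleNr e opprK.
exists p, q, p', q', k; split=> //.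
have k_0 : k != 0 by apply: contraNneq c0 => k_0; rewrite -hk k_0 expr0n.
(* Dependent linear forms would make [u] and [s] multiples of one square. *)
rewrite subr_eq0; apply/eqP => /lin_dependent [j [j' [a [b [e1 e2]]]]].
apply: nu; apply: (@proportional_multiples _ _ _ (lin a b ^+ 2) (j ^+ 2)
  (k^-1 * (j * j'))).
  by rewrite eu e1 exprZn.
apply: (scalerI k_0); rewrite ek e1 e2 scalerA mulVKf //.
by rewrite -scalerAl -scalerAr scalerA expr2.
Qed.

End NormalForm.

(** * Linear changes of variables and reduction to the normal form *)

Section LinearChange.
Variable C : numClosedFieldType.
Implicit Types f g h u v s : {mpoly C[2]}.

Lemma linear_changeB (M : 'M[C]_2) f g :
  linear_change M (f - g) = linear_change M f - linear_change M g.
Proof. exact: comp_mpolyB. Qed.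

Lemma linear_changeD (M : 'M[C]_2) f g :
  linear_change M (f + g) = linear_change M f + linear_change M g.
Proof. exact: comp_mpolyD. Qed.

Lemma linear_changeN (M : 'M[C]_2) f :
  linear_change M (- f) = - linear_change M f.
Proof. exact: comp_mpolyN. Qed.

Lemma linear_changeZ (M : 'M[C]_2) k f :
  linear_change M (k *: f) = k *: linear_change M f.
Proof. exact: comp_mpolyZ. Qed.

Lemma linear_changeM (M : 'M[C]_2) f g :
  linear_change M (f * g) = linear_change M f * linear_change M g.
Proof. exact: rmorphM. Qed.

Lemma linear_change_lin (M : 'M[C]_2) p q :
  linear_change M (lin p q)
  = lin (p * M 0 0 + q * M 1 0) (p * M 0 1 + q * M 1 1).
Proof.
rewrite /lin linear_changeD !linear_changeZ /linear_change /X /Y.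
rewrite !comp_mpolyXU -!tnth_nth !tnth_mktuple /X /Y.
by rewrite !scalerDr !scalerA addrACA -!scalerDl.
Qed.

Lemma det_mx2 (M : 'M[C]_2) : \det M = M 0 0 * M 1 1 - M 0 1 * M 1 0.
Proof.
rewrite (expand_det_row _ 0) !big_ord_recl big_ord0 addr0 /cofactor !det_mx11.
rewrite !mxE /= expr0 mul1r expr1 mulN1r mulrN.
by congr (M _ _ * M _ _ - M _ _ * M _ _); apply: val_inj.
Qed.

Lemma linear_change_exists p q p' q' a b c d :
  p * q' - q * p' != 0 -> a * d - b * c != 0 ->
  exists M : 'M[C]_2, [/\ \det M != 0,
    linear_change M (lin p q) = lin a b & linear_change M (lin p' q') = lin c d].
Proof.
move=> D0 e0; set D := p * q' - q * p' in D0.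
(* The inverse of the matrix with rows (p, q), (p', q') times the matrix with rows (a, b), (c,
   d). *)
pose M : 'M[C]_2 := \matrix_(i, j)
  if i == 0 then if j == 0 then (q' * a - q * c) / D else (q' * b - q * d) / D
  else if j == 0 then (p * c - p' * a) / D else (p * d - p' * b) / D.
have [M00 M01 M10 M11] : [/\ M 0 0 = (q' * a - q * c) / D,
    M 0 1 = (q' * b - q * d) / D, M 1 0 = (p * c - p' * a) / D
    & M 1 1 = (p * d - p' * b) / D] by rewrite !mxE.
exists M; rewrite det_mx2 !linear_change_lin M00 M01 M10 M11.
split; [|by congr lin; rewrite /D; field|by congr lin; rewrite /D; field].
rewrite [X in X != 0](_ : _ = (a * d - b * c) / D); last by rewrite /D; field.
by rewrite mulf_neq0 ?invr_neq0.
Qed.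

(** Write the equation as h1^3 - h3^3 = h4^3 - h2^3, use 4 (a^2 + a b + b^2) = 3 (a + b)^2 + (a -
    b)^2 on both sides, and cancel [h4 - h2]. *)
Lemma difference_of_cubes_identity (A : idomainType) (L h1 h2 h3 h4 : A) :
  h1 ^+ 3 + h2 ^+ 3 = h3 ^+ 3 + h4 ^+ 3 -> h1 - h3 = L ^+ 2 * (h4 - h2) ->
  h4 - h2 != 0 ->
  3 * ((h4 + h2 - L * (h1 + h3)) * (h4 + h2 + L * (h1 + h3)))
  = (L ^+ 6 - 1) * (h4 - h2) ^+ 2.
Proof.
move=> /eqP; rewrite -subr_eq0 => hsum /(canRL (subrK _)) e1 s0.
apply: (mulfI s0); apply/eqP; rewrite -subr_eq0; apply/eqP.
transitivity (- 4 * (h1 ^+ 3 + h2 ^+ 3 - (h3 ^+ 3 + h4 ^+ 3))).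
  by rewrite e1; ring.
by rewrite (eqP hsum) mulr0.
Qed.

(* With s = h4 - h2, d = h1 + h3, e = h4 + h2 and l^2 = t, the sum of cubes
   factors as 3 (e - l d)(e + l d) = (l^6 - 1) s^2. *)
Lemma normal_form (w t : C) h1 h2 h3 h4 :
  w ^+ 2 + w + 1 = 0 -> t != 0 ->
  h1 \is 2.-homog -> h2 \is 2.-homog -> h3 \is 2.-homog -> h4 \is 2.-homog ->
  ~ proportional h1 h2 -> ~ proportional h1 h4 -> ~ proportional h2 h4 ->
  h1 ^+ 3 + h2 ^+ 3 = h3 ^+ 3 + h4 ^+ 3 -> h1 - h3 = t *: (h4 - h2) ->
  exists (l : C) (M : 'M[C]_2), [/\ l * (l ^+ 6 - 1) != 0, \det M != 0 &
    [/\ linear_change M h1 = quad (l ^+ 3 * w ^+ 2) (- 1) (l ^+ 3 * w),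
        linear_change M h2 = quad (- (l * w ^+ 2)) (l ^+ 4) (- (l * w)),
        linear_change M h3 = quad (l ^+ 3 * w) (- 1) (l ^+ 3 * w ^+ 2) &
        linear_change M h4 = quad (- (l * w)) (l ^+ 4) (- (l * w ^+ 2))]].
Proof.
move=> hw t0 hh1 hh2 hh3 hh4 n12 n14 n24 hsum hd.
pose l := sqrtC t; have l2 : l ^+ 2 = t by rewrite sqrtCK.
have l0 : l != 0 by rewrite sqrtC_eq0.
have two : (2 : C) != 0 by rewrite pnatr_eq0.
have three : (3 : C) != 0 by rewrite pnatr_eq0.
pose s := h4 - h2; pose d := h1 + h3; pose e := h4 + h2.
have s0 : s != 0.
  have := @nonproportional_sub _ h4 h2 1; rewrite scale1r; apply.
  by move/proportional_sym.
pose u := e - l *: d; pose v := e + l *: d.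
have uv3 : 3 *: (u * v) = (l ^+ 6 - 1) *: s ^+ 2.
  have := @difference_of_cubes_identity _ l%:MP h1 h2 h3 h4 hsum.
  rewrite -!rmorphXn /= l2 mul_mpolyC => /(_ hd s0).
  rewrite -!mul_mpolyC rmorphB rmorph1 /= => <-.
  by rewrite /u /v /e /d -!mul_mpolyC !rmorph_nat.
have half f g : f = 2^-1 *: ((f + g) + (f - g)).
  by rewrite addrACA subrr addr0 -mulr2n -scaler_nat scalerA mulVf ?scale1r.
have eh1 : h1 = 2^-1 *: (d + t *: s) by rewrite /s -hd /d; apply: half.
have eh3 : h3 = 2^-1 *: (d - t *: s).
  by rewrite /s -hd opprB /d [h1 + _]addrC; apply: half.
have eh4 : h4 = 2^-1 *: (e + s) by apply: half.
have eh2 : h2 = 2^-1 *: (e - s).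
  by rewrite /s opprB /e [h4 + _]addrC; apply: half.
have ee : e = 2^-1 *: (v + u) by apply: half.
have ed : d = (2 * l)^-1 *: (v - u).
  apply: (scalerI l0); rewrite scalerA invfM mulrCA mulfV // mulr1.
  by rewrite /v /u opprB [e + _]addrC; apply: half.
have hu : u \is 2.-homog by rewrite /u /e /d rpredB ?rpredZ ?rpredD.
have hv : v \is 2.-homog by rewrite /v /e /d rpredD ?rpredZ ?rpredD.
have hs : s \is 2.-homog by rewrite /s rpredB.
have [uE vE] : u = e - l *: d /\ v = e + l *: d by [].
clearbody u v s d e.
(* Otherwise [u * v = 0], so [e] is [m *: d] with [m] = l or -l; then m^3 = 1 makes [h1] a multiple
   of [h4], and m^3 = -1 makes it a multiple of [h2]. *)
have l61 : l ^+ 6 - 1 != 0.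
  have degenerate m : m ^+ 2 = t -> m ^+ 6 = 1 -> e <> m *: d.
    move=> m2 m6 em; have : (m ^+ 3 - 1) * (m ^+ 3 + 1) = 0.
      by rewrite -subr_sqr expr1n -exprM m6 subrr.
    move/eqP; rewrite mulf_eq0 => /orP[|].
      rewrite subr_eq0 => /eqP m3; apply: n14.
      apply: (@proportional_multiples _ _ _ h4 t 1); rewrite ?scale1r //.
      rewrite eh1 eh4 em; rewrite scalerA mulrC -scalerA; congr (_ *: _).
      by rewrite scalerDr scalerA -m2 -exprSr m3 scale1r.
    rewrite addr_eq0 => /eqP m3; apply: n12.
    apply: (@proportional_multiples _ _ _ h2 (- t) 1); rewrite ?scale1r //.
    rewrite eh1 eh2 em scalerA mulrC -scalerA; congr (_ *: _).
    by rewrite scalerBr scalerA -m2 mulNr -exprSr m3 opprK scale1r scaleNr opprK.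
  apply/eqP=> l6; move: uv3; rewrite l6 scale0r => /eqP.
  move/eqP: l6; rewrite subr_eq0 => /eqP l6.
  rewrite scaler_eq0 (negbTE three) mulf_eq0 /= => /orP[].
    by rewrite uE subr_eq0 => /eqP; apply: degenerate.
  rewrite vE addr_eq0 -scaleNr => /eqP; apply: degenerate; rewrite ?sqrrN //.
  by rewrite (exprM _ 2 3) sqrrN -exprM.
pose c := (l ^+ 6 - 1) / 3.
have c0 : c != 0 by rewrite mulf_neq0 ?invr_neq0.
have uv : u * v = c *: s ^+ 2.
  by apply: (scalerI three); rewrite uv3 scalerA /c mulrC divfK.
(* If one factor were a multiple of [s], so would be the other, hence [e], and with it both [h2] and
   [h4]. *)
have nprop f g : f * g = c *: s ^+ 2 -> e = 2^-1 *: (f + g) -> ~ proportional f s.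
  move=> fg efg [a [b []]]; rewrite xpair_eqE negb_and => ab eab.
  have a0 : a != 0.
    apply: contraTneq ab => a0; rewrite a0 eqxx /=.
    by move/esym/eqP: eab; rewrite a0 scale0r scaler_eq0 (negbTE s0) orbF => ->.
  have ef : f = (b / a) *: s.
    by apply: (scalerI a0); rewrite eab scalerA mulrC divfK.
  have b0 : b / a != 0.
    apply: contraNneq c0 => b0; move/esym/eqP: fg.
    by rewrite ef b0 scale0r mul0r scaler_eq0 expf_eq0 (negbTE s0) andbF orbF.
  have eg : g = (c / (b / a)) *: s.
    apply: (scalerI b0); apply: (mulfI s0).
    rewrite -scalerAr scalerAl -ef fg scalerA mulrCA mulfV // mulr1 expr2.
    by rewrite -scalerAr.
  have es : e = (2^-1 * (b / a + c / (b / a))) *: s.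
    by rewrite efg ef eg -scalerDl scalerA.
  apply: n24; apply: (@proportional_multiples _ _ _ s
    (2^-1 * (2^-1 * (b / a + c / (b / a)) - 1))
    (2^-1 * (2^-1 * (b / a + c / (b / a)) + 1))).
    by rewrite eh2 es -[RHS]scalerA scalerBl scale1r.
  by rewrite eh4 es -[RHS]scalerA scalerDl scale1r.
have nu : ~ proportional u s by apply: nprop uv _; rewrite addrC.
have nv : ~ proportional v s by apply: nprop ee; rewrite mulrC.
have [p [q [p' [q' [k [D0 k2 eu ev es]]]]]] := mul_eq_square hu hv hs c0 uv nu nv.
(* For the target family [u], [v], [s] are l (1 + l^3) (x + y)^2, l (1 - l^3) (x - y)^2 and l (w^2 -
   w) (x^2 - y^2), so the linear factors must go to P (x + y) and Q (x - y). *)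
pose m := l * (1 + l ^+ 3).
have l30 : 1 + l ^+ 3 != 0.
  apply: contraNneq l61 => l3.
  have -> : l ^+ 6 - 1 = (l ^+ 3 - 1) * (1 + l ^+ 3) by ring.
  by rewrite l3 mulr0.
have m0 : m != 0 by rewrite mulf_neq0.
pose P := sqrtC m; have P2 : P ^+ 2 = m by rewrite sqrtCK.
have P0 : P != 0 by rewrite sqrtC_eq0.
(* Defining [Q] by the product [P * Q] that [s] demands, not as a new square root, fixes its sign;
   its square comes out right because [k ^+ 2 = c] and (w^2 - w)^2 = -3. *)
pose Q := k * (l * (w ^+ 2 - w)) / P.
have w2 : w ^+ 2 = - 1 - w by apply/eqP; rewrite -subr_eq0 -hw; apply/eqP; ring.
have w1 : (w ^+ 2 - w) ^+ 2 = - 3.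
  transitivity (3 * (w ^+ 2 + w + 1) + (w ^+ 2 - 3 * w) * (w ^+ 2 + w + 1) - 3).
    by ring.
  by rewrite hw !mulr0 !add0r.
have Q2 : Q ^+ 2 = l * (1 - l ^+ 3).
  rewrite /Q expr_div_n !exprMn k2 w1 P2 /c /m; field.
  by rewrite l0 l30.
have k0 : k != 0 by apply: contraNneq c0 => k0; rewrite -k2 k0 expr0n.
have ww0 : w ^+ 2 - w != 0.
  by apply/eqP=> ww0; move/esym/eqP: w1; rewrite ww0 expr0n oppr_eq0 (negbTE three).
have Q0 : Q != 0 by rewrite !mulf_neq0 ?invr_neq0.
have [|M [M0 MP MQ]] := @linear_change_exists p q p' q' P P Q (- Q) D0.
  rewrite (_ : _ - _ = - 2 * (P * Q)); last by ring.
  apply: mulf_neq0; last exact: mulf_neq0.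
  by rewrite oppr_eq0.
have lu : linear_change M u = quad m (2 * m) m.
  by rewrite eu expr2 linear_changeM MP linM -P2; congr quad; ring.
have lv : linear_change M v
    = quad (l * (1 - l ^+ 3)) (- (2 * (l * (1 - l ^+ 3)))) (l * (1 - l ^+ 3)).
  by rewrite ev expr2 linear_changeM MQ linM -Q2; congr quad; ring.
have PQ : P * Q = k * (l * (w ^+ 2 - w)) by rewrite /Q mulrCA mulfV // mulr1.
have ls : linear_change M s = quad (l * (w ^+ 2 - w)) 0 (- (l * (w ^+ 2 - w))).
  apply: (scalerI k0); rewrite -linear_changeZ es linear_changeM MP MQ linM quadZ.
  by congr quad; rewrite ?mulrN PQ ?mulr0 //; ring.
exists l, M; split=> //; first by rewrite mulf_neq0.
rewrite eh1 eh2 eh3 eh4 ee ed -l2 !(linear_changeZ, linear_changeB, linear_changeD).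
rewrite lu lv ls !(quadN, quadZ, quadD) /m w2.
split; congr quad; field; rewrite ?l0 //.
Qed.

End LinearChange.

(** * The cube root of unity, and assembly of the classification *)

Lemma omega_minimal (R : realType) : omega R ^+ 2 + omega R + 1 = 0.
Proof.
pose a : R := 2 * pi / 3; pose c := cos a; pose s := sin a.
have s0 : s != 0.
  have p0 := pi_gt0 R.
  rewrite lt0r_neq0 // sin_gt0_pi // /a divr_gt0 ?mulr_gt0 //=.
  by rewrite ltr_pdivrMr // mulrC ltr_pM2l // ltr_nat.
(* Since 2a = -a + 2 pi, the sine of 2a is - sin a; the duplication formula and sin a != 0 then give
   cos a = -1/2. *)
have a2 : a *+ 2 = - a + pi *+ 2 by rewrite /a; field.
have s2 : s ^+ 2 = 1 - c ^+ 2 by rewrite -(cos2Dsin2 a) addrC addKr.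
have hc : c = - 2^-1.
  have : s * (2 * c + 1) = 0.
    have := sin_mulr2n a; rewrite a2 sinD2pi sinN -/s -/c => e.
    by transitivity (c * s *+ 2 - (- s)); [ring | rewrite e subrr].
  move/eqP; rewrite mulf_eq0 (negbTE s0) addr_eq0 => /eqP e.
  by apply: (mulfI (_ : (2 : R) != 0)); rewrite ?pnatr_eq0 // e mulrN mulfV ?pnatr_eq0.
rewrite /omega -/a -/c -/s expr2; apply/eqP; rewrite eq_complex /=; apply/andP; split.
  apply/eqP; transitivity (c ^+ 2 - s ^+ 2 + c + 1); first by ring.
  by rewrite s2 hc; field.
by apply/eqP; rewrite hc; field.
Qed.

Lemma Ffamily_quad (R : realType) (l : R[i]) (w := omega R) :
  [/\ F3 l = quad (l ^+ 3 * w ^+ 2) (- 1) (l ^+ 3 * w),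
      F4 l = quad (- (l * w ^+ 2)) (l ^+ 4) (- (l * w)),
      F5 l = quad (l ^+ 3 * w) (- 1) (l ^+ 3 * w ^+ 2) &
      F6 l = quad (- (l * w)) (l ^+ 4) (- (l * w ^+ 2))].
Proof. by rewrite /F3 /F4 /F5 /F6 /quad; split; rewrite ?scaleNr ?scale1r. Qed.

Lemma identified_cubes (K : fieldType) (g1 g2 g3 g4 h1 h2 h3 h4 : {mpoly K[2]}) :
  g1 ^+ 3 = h1 ^+ 3 -> g2 ^+ 3 = h2 ^+ 3 ->
  g3 ^+ 3 = h3 ^+ 3 -> g4 ^+ 3 = h4 ^+ 3 ->
  identified ((g1, g2), (g3, g4)) ((h1, h2), (h3, h4)).
Proof. by rewrite /identified /cubes => -> -> -> ->. Qed.

Lemma identified_swap (K : fieldType) (g1 g2 g3 g4 : {mpoly K[2]}) H :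
  identified ((g1, g2), (g4, g3)) H -> identified ((g1, g2), (g3, g4)) H.
Proof.
rewrite /identified => <-; rewrite /cubes.
by rewrite (fsetUC [fset g3 ^+ 3]%fset).
Qed.

(** The cube roots of unity in the matching are absorbed into [h2] and [h3]; cubing removes them, so
    the identification is unaffected. *)
Lemma matched_normal_form (R : realType) (h1 h2 h3 h4 : {mpoly R[i][2]}) :
  h1 \is 2.-homog -> h2 \is 2.-homog -> h3 \is 2.-homog -> h4 \is 2.-homog ->
  ~ proportional h1 h2 -> ~ proportional h1 h4 -> ~ proportional h2 h4 ->
  h1 ^+ 3 + h2 ^+ 3 = h3 ^+ 3 + h4 ^+ 3 -> matched h1 h2 h3 h4 ->
  exists (l : R[i]) (M : 'M[R[i]]_2),
    [/\ l * (l ^+ 6 - 1) != 0, \det M != 0 &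
      identified ((linear_change M h1, linear_change M h2),
                  (linear_change M h3, linear_change M h4)) (Ffamily l)].
Proof.
move=> hh1 hh2 hh3 hh4 n12 n14 n24 hsum [r [s [t [r3 s3 t0 hd]]]].
have [_ s0] := cube_root1_inv s3.
have hsum' : h1 ^+ 3 + (s *: h2) ^+ 3 = (r *: h3) ^+ 3 + h4 ^+ 3.
  by rewrite !exprZn r3 s3 !scale1r.
have n12' : ~ proportional h1 (s *: h2).
  by rewrite -[h1]scale1r => /(proportionalZ (oner_neq0 _) s0).
have n24' : ~ proportional (s *: h2) h4.
  by rewrite -[h4]scale1r => /(proportionalZ s0 (oner_neq0 _)).
have [l [M [l0 M0 [e1 e2 e3 e4]]]] := normal_form (omega_minimal R) t0 hh1
  (rpredZ s hh2) (rpredZ r hh3) hh4 n12' n14 n24' hsum' hd.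
have [E3 E4 E5 E6] := Ffamily_quad l.
have c1 : linear_change M h1 ^+ 3 = F3 l ^+ 3 by rewrite E3 -e1.
have c2 : linear_change M h2 ^+ 3 = F4 l ^+ 3.
  by rewrite E4 -e2 linear_changeZ exprZn s3 scale1r.
have c3 : linear_change M h3 ^+ 3 = F5 l ^+ 3.
  by rewrite E5 -e3 linear_changeZ exprZn r3 scale1r.
have c4 : linear_change M h4 ^+ 3 = F6 l ^+ 3 by rewrite E6 -e4.
exists l, M; split; [exact: l0 | exact: M0 |].
exact: identified_cubes c1 c2 c3 c4.
Qed.

Lemma flip_sum_cubes (A : comNzRingType) (a b c d : A) :
  a ^+ 3 + b ^+ 3 = c ^+ 3 + d ^+ 3 -> a ^+ 3 + (- c) ^+ 3 = (- b) ^+ 3 + d ^+ 3.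
Proof.
move=> /eqP; rewrite -subr_eq0 => /eqP e.
by apply/eqP; rewrite -subr_eq0 -e; apply/eqP; ring.
Qed.

Theorem theorem1p1 (R : realType) (f1 f2 f3 f4 : {mpoly R[i][2]})
    (hf1 : f1 \is 2.-homog) (hf2 : f2 \is 2.-homog)
    (hf3 : f3 \is 2.-homog) (hf4 : f4 \is 2.-homog)
    (h12 : ~ proportional f1 f2) (h13 : ~ proportional f1 f3)
    (h14 : ~ proportional f1 f4) (h23 : ~ proportional f2 f3)
    (h24 : ~ proportional f2 f4) (h34 : ~ proportional f3 f4)
    (hsum : f1 ^+ 3 + f2 ^+ 3 = f3 ^+ 3 + f4 ^+ 3) :
  exists (l : R[i]) (M : 'M[R[i]]_2),
    [/\ l * (l ^+ 6 - 1) != 0,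
        \det M != 0 &
        let G := ((linear_change M f1, linear_change M f2),
                  (linear_change M f3, linear_change M f4)) in
        [\/ identified G (Ffamily l),
            identified (flip1 G) (Ffamily l) |
            identified (flip2 G) (Ffamily l)]].
Proof.
case: (sum_cubes_matched hf1 hf2 hf3 hf4 h12 h13 h14 h23 h24 h34 hsum) => m.
- have [l [M [l0 M0 e]]] :=
    matched_normal_form hf1 hf2 hf3 hf4 h12 h14 h24 hsum m.
  by exists l, M; split; [exact: l0 | exact: M0 | apply: Or31].
(* Exchanging [f3] and [f4] does not change the unordered family. *)
- have hsum' : f1 ^+ 3 + f2 ^+ 3 = f4 ^+ 3 + f3 ^+ 3 by rewrite hsum addrC.
  have [l [M [l0 M0 e]]] :=
    matched_normal_form hf1 hf2 hf4 hf3 h12 h13 h23 hsum' m.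
  exists l, M; split; [exact: l0 | exact: M0 | apply: Or31].
  exact: identified_swap e.
(* The third matching concerns [f1], [- f3], [- f2], [f4], which is the first flip. *)
- have hsum' := flip_sum_cubes hsum.
  have n13 : ~ proportional f1 (- f3) by move/proportionalN.
  have n34 : ~ proportional (- f3) f4.
    by move/proportional_sym/proportionalN/proportional_sym.
  have [l [M [l0 M0 e]]] := matched_normal_form hf1 (rpredNr hf3) (rpredNr hf2)
    hf4 n13 h14 n34 hsum' m.
  rewrite (linear_changeN M f3) (linear_changeN M f2) in e.
  by exists l, M; split; [exact: l0 | exact: M0 | apply: Or32].
Qed.
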